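(* For every integer $d\ge 1$ with $d\ne 3$, the $d$-cube is strongly $\lfloor (d+1)/2\rfloor$-linked.
   Context: A $d$-polytope $P$ is strongly $\lfloor (d+1)/2\rfloor$-linked if its graph (vertices and edges of $P$) has at least $d+1$ vertices and, for every set $X$ of exactly $d+1$ vertices and every labelling and pairing $Y=\{\{s_1,t_1\},\dots,\{s_k,t_k\}\}$, $k=\lfloor (d+1)/2\rfloor$, of $2k$ vertices of $X$, there exist pairwise vertex-disjoint paths $L_i$ joining $s_i$ and $t_i$ ($i=1,\dots,k$) in the graph of $P$ such that no path $L_i$ contains a vertex of $X$ that is not paired in $Y$. *)

(* Defs.v *)
From HB Require Import structures.
From mathcomp Require Import all_boot all_order all_algebra.
From mathcomp Require Import boolp classical_sets functions cardinality reals.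
From mathcomp Require Import convex.

Set Implicit Arguments.
Unset Strict Implicit.
Unset Printing Implicit Defensive.

Import Order.TTheory GRing.Theory Num.Theory.

Local Open Scope classical_set_scope.
Local Open Scope ring_scope.

Definition conv_hull (R : realType) n (S : set 'rV[R]_n) : set 'rV[R]_n :=
  smallest (@convex_set R 'rV[R]_n) S.

(* The differences of the points of s span the direction space of their affine
   hull, so P is a polytope of affine dimension d, possibly with d < n. *)
Definition is_polytope (R : realType) n (d : nat) (P : set 'rV[R]_n) : Prop :=
  exists s : seq 'rV[R]_n,
    [/\ s != [::], P = conv_hull [set` s] &
        \dim <<[seq x - y | x <- s, y <- s]>>%VS = d].

(* Exposed faces, which for a polytope are all its faces; P itself is the case
   c = 0, m = 0. *)
Definition is_face (R : realType) n (P F : set 'rV[R]_n) : Prop :=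
  exists (c : 'rV[R]_n) (m : R),
    (forall x, P x -> \sum_(i < n) c 0 i * x 0 i <= m) /\
    F = [set x | P x /\ \sum_(i < n) c 0 i * x 0 i = m].

Definition vertices (R : realType) n (P : set 'rV[R]_n) : set 'rV[R]_n :=
  [set v | is_face P [set v]].

(* The 1-dimensional faces of a polytope are segments with distinct vertices
   as endpoints. *)
Definition adjacent (R : realType) n (P : set 'rV[R]_n) : rel 'rV[R]_n :=
  fun u v => `[< [/\ vertices P u, vertices P v, u <> v &
                     is_face P (conv_hull [set u; v])] >].

(* The path visits u :: p, in this order. *)
Definition is_path (R : realType) n (P : set 'rV[R]_n)
    (u v : 'rV[R]_n) (p : seq 'rV[R]_n) : Prop :=
  [/\ vertices P u, path (adjacent P) u p, last u p = v & uniq (u :: p)].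

Definition strongly_linked (R : realType) n (d : nat) (P : set 'rV[R]_n) :
    Prop :=
  let k := (d.+1)./2 in
  [/\ is_polytope d P,
      (`I_d.+1 #<= vertices P)%card &
      forall X : set 'rV[R]_n,
        X `<=` vertices P -> (X #= `I_d.+1)%card ->
      forall s t : 'I_k -> 'rV[R]_n,
        (forall i, X (s i) /\ X (t i)) ->
        injective s -> injective t -> (forall i j, s i <> t j) ->
      exists L : 'I_k -> seq 'rV[R]_n,
        [/\ forall i, is_path P (s i) (t i) (L i),
            forall i j, i != j ->
              forall x, x \in s i :: L i -> x \notin s j :: L j &
            forall i x, x \in s i :: L i -> X x ->
              exists j, x = s j \/ x = t j]].

Definition cube (R : realType) (d : nat) : set 'rV[R]_d :=
  conv_hull [set v | forall i, v 0 i = 1 \/ v 0 i = -1].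

(* Main.v *)
(* Induction on the dimension, for the following more flexible statement: a set
   [X] of at most [m + 1] vertices of an [m]-cube contains some disjoint pairs
   (any number if [m >= 4], at most one if [m < 4]); then the pairs can be joined
   inside disjoint vertex sets that meet [X] only in the pair they join.

   By Bondy's theorem applied to [X] minus a point [x], some direction [i] is
   such that every edge of [X] parallel to [i] contains [x].  Cut the cube along
   [i].
   - If both halves meet [X], each pair separated by the cut is completed in one
     half by projecting its far terminal there.  At most one pair per half is
     forced to stay there by the edge of [X] at [x], so the pairs can be
     distributed with at most [m] marked vertices in each half.
   - If [X] lies in one half, forget one terminal [t] of a pair [(s, t)], link
     the other pairs in that half, and join [s] to [t] through the other half.
     If a path runs through [t], say as [.. a t b ..], it is rerouted from [a]
     to [b] through the other half too, which has to link two pairs.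
   Since two pairs need not be linked in dimension 3, the case of two pairs in
   dimension 4 is checked by computation. *)
Require Import Defs.
From mathcomp Require Import all_boot all_order all_algebra reals.
From mathcomp Require Import zify.

Set Implicit Arguments.
Unset Strict Implicit.
Unset Printing Implicit Defensive.

(** * Finite sets of prescribed size, and splitting under capacities *)

Lemma set_between (T : finType) (A B : {set T}) m :
  A \subset B -> #|A| <= m <= #|B| ->
  exists C : {set T}, [/\ A \subset C, C \subset B & #|C| = m].
Proof.
move=> + /andP[]; elim: {A}(m - #|A|) {-2}A (erefl (m - #|A|)) => [|n IHn] A.
  by move=> mA AB Am mB; exists A; split=> //; lia.
move=> mA AB Am mB.
have : A \proper B by rewrite properEcard AB; lia.
case/properP=> _ [x xB xA].
have cA : #|x |: A| = #|A|.+1 by rewrite cardsU1 xA.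
have [||||C [AC CB Cm]] := IHn (x |: A); rewrite ?cA; try lia.
  by rewrite subUset sub1set xB.
exists C; split=> //; apply: subset_trans AC; exact: subsetUr.
Qed.

(** Serves to distribute the separated pairs between the two halves of a cube. [T1] is taken between
    [F1] and [S :\: F0], as large as [b] permits; what is left of [S] is then [F0] alone or has at
    most [#|S| - b] elements. *)
Lemma set_split (T : finType) (S F0 F1 : {set T}) a b :
  F0 \subset S -> F1 \subset S -> [disjoint F0 & F1] ->
  #|F0| <= a -> #|F1| <= b -> #|S| <= a + b ->
  exists T1 : {set T}, [/\ F1 \subset T1, T1 \subset S, [disjoint F0 & T1],
     #|S :\: T1| <= a & #|T1| <= b].
Proof.
move=> F0S F1S dF F0a F1b Sab.
have F1D : F1 \subset S :\: F0 by rewrite subsetD F1S disjoint_sym.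
have cD : #|S :\: F0| = #|S| - #|F0| by rewrite cardsD (setIidPr F0S).
have le1 := subset_leq_card F1D.
have [||T1 [FT TS cT]] := @set_between _ F1 (S :\: F0) (minn b #|S :\: F0|).
- exact: F1D.
- by rewrite leq_min F1b le1 geq_minr.
have TS' : T1 \subset S by apply: subset_trans TS (subsetDl _ _).
exists T1; split=> //.
- by move: TS; rewrite subsetD disjoint_sym => /andP[].
- rewrite cardsD (setIidPr TS') cT; lia.
- by rewrite cT geq_minl.
Qed.

(** * Pairs of disjoint paths in the 4-cube, by computation *)

Definition code := seq bool.

Definition code_flip (m : nat) (c : code) : code :=
  set_nth false c m (~~ nth false c m).

Definition code_dist (c c' : code) : nat := count id ([seq p.1 (+) p.2 | p <- zip c c']).

Fixpoint codes (n : nat) : seq code :=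
  if n is n'.+1 then [seq b :: c | b <- [:: false; true], c <- codes n'] else [:: [::]].

Definition code_nbrs (c : code) : seq code := [seq code_flip m c | m <- iota 0 4].

(* Only chordless walks are generated: the new vertex has exactly one neighbour
   on the walk so far. *)
Fixpoint code_walks (n : nat) (past : seq code) (x y : code) : seq (seq code) :=
  if x == y then [:: [:: x]] else
  if n is n'.+1 then
    if code_dist x y <= n then
      [seq x :: p | p <- flatten [seq code_walks n' (x :: past) z y |
         z <- code_nbrs x & ~~ has (fun c => c \in past) (z :: code_nbrs z)]]
    else [::]
  else [::].

Lemma code_walksS n past x y : code_walks n.+1 past x y =
  if x == y then [:: [:: x]] else
  if code_dist x y <= n.+1 then
    [seq x :: p | p <- flatten [seq code_walks n (x :: past) z y |
       z <- code_nbrs x & ~~ has (fun c => c \in past) (z :: code_nbrs z)]]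
  else [::].
Proof. by []. Qed.

(** All paths between two vertices of a cube have lengths of the same parity, so this bound admits
    the shortest paths and those with two extra edges. *)
Definition code_paths (x y : code) : seq (seq code) :=
  code_walks (code_dist x y).+2 [::] x y.

(* [orb], hence also [has], evaluates both of its arguments under [vm_compute]. *)
Fixpoint lazy_has (T : Type) (a : pred T) (s : seq T) : bool :=
  if s is x :: s' then if a x then true else lazy_has a s' else false.

Lemma lazy_hasE (T : Type) (a : pred T) s : lazy_has a s = has a s.
Proof. by elim: s => //= x s ->; case: (a x). Qed.

(** By translation [s1] may be put at the origin. The vertex [o] is a possible fifth element of [X];
    when it coincides with a terminal it imposes nothing, which covers the case where [X] consists
    of the four terminals. *)
Definition code_check : bool :=
  let cs := codes 4 in let s1 := nseq 4 false in
  all (fun t1 => if t1 == s1 then true else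
    let P1 := code_paths s1 t1 in
  all (fun s2 => if s2 \in [:: s1; t1] then true else
    let P2 := [seq p <- P1 | s2 \notin p] in
  all (fun t2 => if t2 \in [:: s1; t1; s2] then true else
    let P3 := [seq p <- P2 | t2 \notin p] in
    let Q := [seq q <- code_paths s2 t2 | (s1 \notin q) && (t1 \notin q)] in
  all (fun o =>
    let ok := if o \in [:: s1; t1; s2; t2] then xpredT else fun p => o \notin p in
    lazy_has (fun p => if ok p then
      lazy_has (fun q => if ok q then ~~ has (mem p) q else false) Q
      else false) P3) cs) cs) cs) cs.

Lemma code_checkT : code_check = true.
Proof. vm_cast_no_check (erefl true). Qed.

Lemma mem_codes n (c : code) : size c = n -> c \in codes n.
Proof.
elim: n c => [|n IHn] [|b c] //= [/IHn cn].
by case: b; rewrite !mem_cat (map_f (cons _) cn) ?orbT.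
Qed.

Lemma size_code_flip m c : m < 4 -> size c = 4 -> size (code_flip m c) = 4.
Proof. by move=> m4 c4; rewrite size_set_nth c4; apply/maxn_idPr. Qed.

Lemma code_walksP n past x y p : p \in code_walks n past x y -> size x = 4 ->
  exists q, [/\ p = x :: q, path (fun c c' => c' \in code_nbrs c) x q,
                last x q = y & all (fun c => size c == 4) p].
Proof.
elim: n past x p => [|n IHn] past x p; [rewrite /=|rewrite code_walksS]; case: eqVneq => [->|_] //.
- by rewrite inE => /eqP-> x4; exists [::]; split=> //=; rewrite x4.
- by rewrite inE => /eqP-> x4; exists [::]; split=> //=; rewrite x4.
case: ifP => // _ /mapP[q /flattenP[ps /mapP[z]]].
rewrite mem_filter => /andP[_ zn] -> qz -> x4.
have z4 : size z = 4.
  by case/mapP: zn => m; rewrite mem_iota => /andP[_ m4] ->; apply: size_code_flip.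
have [r [-> rp rl r4]] := IHn _ _ _ qz z4.
by exists (z :: r); rewrite /= zn x4; split.
Qed.

Lemma code_pathsP (t1 s2 t2 o : code) : let s1 := nseq 4 false in
  size t1 = 4 -> size s2 = 4 -> size t2 = 4 -> size o = 4 ->
  uniq [:: s1; t1; s2; t2] ->
  exists p q, [/\ p \in code_paths s1 t1, q \in code_paths s2 t2, ~~ has (mem p) q &
    o \notin [:: s1; t1; s2; t2] -> (o \notin p) && (o \notin q)].
Proof.
move=> s1 t14 s24 t24 o4 un; have check := code_checkT; cbv delta [code_check] zeta in check.
rewrite /= !inE !negb_or andbT in un; case/and3P: un => [/and3P[st ss stt] /andP[ts tt] s2t].
have E1 : (t1 == nseq 4 false) = false by rewrite eq_sym (negPf st).
have E2 : (s2 \in [:: nseq 4 false; t1]) = false.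
  by rewrite !inE ![s2 == _]eq_sym (negPf ss) (negPf ts).
have E3 : (t2 \in [:: nseq 4 false; t1; s2]) = false.
  by rewrite !inE ![t2 == _]eq_sym (negPf stt) (negPf tt) (negPf s2t).
move/allP: check => /(_ t1 (mem_codes t14)); rewrite E1.
move/allP => /(_ s2 (mem_codes s24)); rewrite E2.
move/allP => /(_ t2 (mem_codes t24)); rewrite E3.
move/allP => /(_ o (mem_codes o4)).
set ok := (X in lazy_has (fun p => if X p then _ else _)).
have okP r : ok r -> o \notin [:: s1; t1; s2; t2] -> o \notin r.
  by rewrite /ok; case: ifP.
rewrite lazy_hasE => /hasP[p]; rewrite !mem_filter => /and3P[_ _ pP].
case: ifP => // /okP op; rewrite lazy_hasE => /hasP[q]; rewrite mem_filter => /andP[_ qQ].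
case: ifP => // /okP oq pq; exists p, q; split=> [//|//|//|no]; by rewrite (op no) (oq no).
Qed.

(** * The combinatorial cube *)

Section Hypercube.
Variable I : finType.
Local Notation V := {ffun I -> bool}.
Implicit Types (i j : I) (u v w x y : V) (D : {set I}) (X Y C W : {set V}).

Definition flip i u : V := [ffun j => u j (+) (j == i)].
Definition upd i b u : V := [ffun j => if j == i then b else u j].
(** The face through [v] with [D] as its set of free directions, hence of dimension [#|D|]. *)
Definition subcube D v := [set u : V | [forall (j | j \notin D), u j == v j]].
Definition adj u w := [exists i, w == flip i u].

Lemma flipK i : involutive (flip i).
Proof. by move=> u; apply/ffunP => j; rewrite !ffunE addbK. Qed.

Lemma flip_i i u : flip i u i = ~~ u i.
Proof. by rewrite ffunE eqxx addbT. Qed.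

Lemma flip_neq i u : flip i u != u.
Proof. by apply/eqP => /(congr1 (fun w : V => w i)); rewrite flip_i; case: (u i). Qed.

Lemma upd_i i b u : upd i b u i = b.
Proof. by rewrite ffunE eqxx. Qed.

Lemma upd_id i b u : u i = b -> upd i b u = u.
Proof. by move=> <-; apply/ffunP => j; rewrite ffunE; case: eqP => [->|]. Qed.

Lemma upd_flip i b u : u i != b -> upd i b u = flip i u.
Proof.
move=> ub; apply/ffunP => j; rewrite !ffunE; case: eqP => [->|]; last by rewrite addbF.
by move: ub; case: (u i) b => [] [].
Qed.

Lemma adj_sym : symmetric adj.
Proof. by move=> u w; apply/existsP/existsP => -[i /eqP->]; exists i; rewrite flipK. Qed.

Lemma adj_flip i u : adj u (flip i u).
Proof. by apply/existsP; exists i. Qed.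

Lemma subcubeP D v u : reflect (forall j, j \notin D -> u j = v j) (u \in subcube D v).
Proof. by rewrite inE; apply: (iffP forall_inP) => H j /H /eqP. Qed.

Lemma subcube_refl D v : v \in subcube D v.
Proof. exact/subcubeP. Qed.

Lemma eq_subcube D v w : w \in subcube D v -> subcube D w = subcube D v.
Proof.
move=> /subcubeP wv; apply/setP => u; apply/subcubeP/subcubeP => H j jD.
  by rewrite H ?wv.
by rewrite H ?wv.
Qed.

Lemma flip_subcube D v i u : i \in D -> (flip i u \in subcube D v) = (u \in subcube D v).
Proof.
move=> iD; apply/subcubeP/subcubeP => H j jD; have := H j jD; rewrite ffunE;
  by have /negPf -> : j != i by [apply: contraNneq jD => ->]; rewrite addbF.
Qed.

(** Each half of a cube cut along [i] is again a subcube, with one direction fewer, so the induction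
    applies to it. *)
Lemma mem_side D v i b u : i \in D ->
  (u \in subcube (D :\ i) (upd i b v)) = (u \in subcube D v) && (u i == b).
Proof.
move=> iD; apply/subcubeP/andP.
  move=> H; split; last by rewrite (H i) ?upd_i // setD11.
  apply/subcubeP => j jD; rewrite H ?ffunE; last by rewrite inE (negPf jD) andbF.
  by case: eqP jD => // ->; rewrite iD.
case=> /subcubeP H /eqP ub j; rewrite !inE negb_and negbK ffunE.
by case: eqP => [->|_] //= /H.
Qed.

(** * Linked vertices *)

Definition inside C u w := [&& adj u w, u \in C & w \in C].
(** Disjoint vertex sets stand in for disjoint paths: pieces are joined by transitivity, and
    [linkedP] recovers simple paths. Membership of the ends is required separately because [connect]
    is reflexive even outside [C]. *)
Definition linked C x y := [&& x \in C, y \in C & connect (inside C) x y].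

Lemma inside_sym C : symmetric (inside C).
Proof. by move=> u w; rewrite /inside adj_sym [(u \in C) && _]andbC. Qed.

Lemma linkedP C x y :
  reflect (exists p, [/\ path adj x p, last x p = y, uniq (x :: p) & {subset x :: p <= C}])
          (linked C x y).
Proof.
apply: (iffP and3P) => [[xC yC /connectP[p pp ->]]|[p [pp lp up sp]]].
  case/shortenP: pp => q pq uq _; exists q; split=> // {uq}.
    by apply: sub_path pq => u w /and3P[].
  move: xC pq; elim: q x => [|z q IHq] x xC /=.
    by move=> _ u; rewrite inE => /eqP->.
  case/andP=> /and3P[_ _ zC] /(IHq z zC) H u.
  by rewrite inE => /predU1P[->|/H].
split; first by rewrite sp ?mem_head.
  by rewrite sp // -lp mem_last.
apply/connectP; exists p => //.
elim: p x pp sp {lp up} => //= z p IHp x /andP[xz pp] sp.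
rewrite {1}/inside xz !sp ?inE ?eqxx ?orbT //=.
by apply: IHp => // u up; apply: sp; rewrite inE up orbT.
Qed.

Lemma linked_refl C x : x \in C -> linked C x x.
Proof. by move=> xC; rewrite /linked xC connect0. Qed.

Lemma linked_sym C x y : linked C x y = linked C y x.
Proof.
rewrite /linked andbCA; congr [&& _, _ & _].
by apply: sym_connect_sym; apply: inside_sym.
Qed.

Lemma linked_trans C y x z : linked C x y -> linked C y z -> linked C x z.
Proof.
by case/and3P=> xC _ xy /and3P[_ zC yz]; rewrite /linked xC zC (connect_trans xy).
Qed.

Lemma linkedS C C' x y : C \subset C' -> linked C x y -> linked C' x y.
Proof.
move=> /subsetP CC /linkedP[p [pp lp up sp]]; apply/linkedP; exists p.
by split=> // u /sp /CC.
Qed.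

Lemma linked_adj C x y : adj x y -> x \in C -> y \in C -> linked C x y.
Proof. by move=> xy xC yC; rewrite /linked xC yC connect1 // /inside xy xC. Qed.

(** A simple path that cannot avoid [z] visits it exactly once; [a] and [b] are its neighbours on
    the path, between which a detour can be inserted. *)
Lemma linked_detour C x y z : linked C x y -> z != x -> z != y ->
  ~~ linked (C :\ z) x y ->
  exists a b, [/\ a != b, adj a z, adj z b, linked (C :\ z) x a & linked (C :\ z) b y].
Proof.
move=> /linkedP[p [pp lp up sp]] zx zy nl.
have zp : z \in p.
  apply: contraNT nl => zp; apply/linkedP; exists p; split=> // u uxp.
  rewrite !inE sp // andbT; apply: contraNneq zp => uz.
  by move: uxp zx; rewrite uz inE eq_sym => /predU1P[->|//]; rewrite eqxx.
case/splitPr: zp pp lp up sp => p1 [|b p2].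
  by rewrite last_cat /= => _ zE; rewrite zE eqxx in zy.
rewrite cat_path last_cat /= => /and4P[pp1 az zb pp2] lp.
rewrite cat_uniq /= => /andP[xp] /and3P[up1].
rewrite !negb_or => /and3P[zp1 bp1 hp] /and3P[zb2 bp2 up2] sp.
have {}zb2 : z \notin b :: p2 by rewrite in_cons negb_or.
have {}sp : {subset x :: p1 <= C :\ z} /\ {subset b :: p2 <= C :\ z}.
  split=> u ui; rewrite !inE.
    rewrite sp ?andbT; last by move: ui; rewrite !inE mem_cat => /orP[->//|->]; rewrite orbT.
    by apply: contraTneq ui => ->; rewrite inE (negPf zp1) orbF.
  rewrite sp ?andbT; last by move: ui; rewrite !inE mem_cat !inE => /orP[->|->]; rewrite !orbT.
  by apply: contraNneq zb2 => <-.
case: sp => sp1 sp2; exists (last x p1), b; split=> //.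
- apply: contraNneq xp => bE; move: (mem_last x p1); rewrite bE inE (negPf bp1) orbF.
  by move/eqP=> <-; rewrite mem_cat !inE eqxx !orbT.
- apply/linkedP; exists p1; split=> //=; rewrite up1 andbT.
  by apply: contraNN xp; rewrite mem_cat => ->.
- by apply/linkedP; exists p2; split=> //=; rewrite bp2.
Qed.

(** * Bondy's theorem *)

(** Cut [Y] along some [i] in [D]; an edge parallel to [i] makes both sides nonempty. Every other
    direction of [D] has an edge within one side, so by induction [#|D|] is at most 1 plus the sum
    of the two side sizes, each lowered by 1. *)
Lemma edge_directions_lt D Y : Y != set0 ->
  (forall i, i \in D -> exists2 u, u \in Y & flip i u \in Y) -> #|D| < #|Y|.
Proof.
elim: {Y}#|Y| {-2}Y (leqnn #|Y|) D => [|n IHn] Y Yn D Y0 HD.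
  by move: Yn; rewrite leqn0 cards_eq0 (negPf Y0).
have [D0|[i iD]] := set_0Vmem D; first by rewrite D0 cards0 card_gt0.
pose side (b : bool) : {set V} := [set u in Y | u i == b].
pose dirs (b : bool) : {set I} :=
  [set j in D :\ i | [exists u, (u \in side b) && (flip j u \in side b)]].
have cY : #|Y| = #|side true| + #|side false|.
  rewrite -(cardsID (side true) Y); congr (_ + _); apply: eq_card => u.
    by rewrite !inE andbA andbb.
  by rewrite !inE; case: (u \in Y) => //=; case: (u i).
have side0 b : 0 < #|side b|.
  have [u uY fY] := HD i iD; rewrite card_gt0; apply/set0Pn.
  by case: (eqVneq (u i) b) => ub; [exists u|exists (flip i u)];
    rewrite inE ?uY ?fY ?ub ?flip_i //=; case: (u i) b ub => [] [].
have lt b : #|dirs b| < #|side b|.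
  apply: IHn; first by move: Yn; rewrite cY; have := side0 (~~ b); case: b => /=; lia.
    by rewrite -card_gt0 side0.
  by move=> j; rewrite inE => /andP[_ /existsP[u /andP[]]]; exists u.
have Dsub : D \subset i |: (dirs true :|: dirs false).
  apply/subsetP => j jD; rewrite 5!inE; case: eqVneq => //= ji.
  have [u uY fY] := HD j jD; rewrite !inE ji jD /=.
  suff ex : [exists w, (w \in side (u i)) && (flip j w \in side (u i))].
    by case: (u i) ex => ->; rewrite ?orbT.
  by apply/existsP; exists u; rewrite !inE uY fY ffunE [i == j]eq_sym (negPf ji) addbF eqxx.
have := subset_leq_card Dsub; rewrite cardsU1; have := (leq_card_setU (dirs true) (dirs false)).1.
by have := lt true; have := lt false; rewrite cY; case: (_ \notin _) => /=; lia.
Qed.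

(* Deleting [x] leaves at most [#|D|] vertices, so Bondy's theorem gives a
   direction whose edges within [X] all contain [x]. *)
Lemma exists_sparse_direction D X x : D != set0 -> x \in X -> #|X| <= #|D|.+1 ->
  exists2 i, i \in D & forall u, u \in X -> flip i u \in X -> x = u \/ x = flip i u.
Proof.
move=> D0 xX cX; have cX' : #|X :\ x| <= #|D| by rewrite (cardsD1 x X) xX in cX.
have [/existsP[i /andP[iD /forallP Hi]]|] :=
  boolP [exists i, (i \in D) && [forall u, (u \in X :\ x) ==> (flip i u \notin X :\ x)]].
  exists i => // u uX fX; move/implyP: (Hi u); rewrite !inE uX fX andbT andbT.
  by case: eqVneq => [->|_]; [left|case: eqVneq => [->|_ /(_ isT)]; [right|]].
rewrite negb_exists => /forallP H.
have H' i : i \in D -> exists2 u, u \in X :\ x & flip i u \in X :\ x.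
  move=> iD; move: (H i); rewrite iD /= negb_forall => /existsP[u].
  by rewrite negb_imply negbK => /andP[]; exists u.
have [i iD] := set0Pn _ D0.
have X0 : X :\ x != set0 by have [u uX _] := H' i iD; apply/set0Pn; exists u.
by have := edge_directions_lt X0 H'; rewrite ltnNge cX'.
Qed.

(** * Linkages *)

Variable K : finType.
Implicit Types (A : {set K}) (k : K) (b c : bool) (e : K -> bool -> V).

(** [e k false] and [e k true] are the two ends of pair [k]. Since [A] selects the pairs in use, the
    induction can drop pairs without reindexing. *)
Definition terminals X A e :=
  (forall k c, k \in A -> e k c \in X) /\
  (forall k k' c c', k \in A -> k' \in A -> e k c = e k' c' -> k = k' /\ c = c').

Definition linkage W X A e :=
  exists C : K -> {set V},
    [/\ forall k, k \in A -> C k \subset W,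
        forall k, k \in A -> linked (C k) (e k false) (e k true),
        forall k x, k \in A -> x \in C k -> x \in X -> exists c, x = e k c &
        forall k k', k \in A -> k' \in A -> k != k' -> [disjoint C k & C k']].

(* A single pair is also linked in dimensions 1 to 3, where the induction starts. *)
Definition linkable m := forall D v X A e,
  #|D| = m -> X \subset subcube D v -> #|X| <= m.+1 -> terminals X A e ->
  #|A| <= 1 \/ 4 <= m -> linkage (subcube D v) X A e.

Lemma leq_terminals X A e : terminals X A e -> #|A| * 2 <= #|X|.
Proof.
case=> eX einj.
have <- : #|[set e p.1 p.2 | p in setX A [set: bool]]| = #|A| * 2.
  rewrite card_in_imset; first by rewrite cardsX cardsT card_bool.
  move=> [k c] [k' c']; rewrite !inE !andbT /= => kA kA' E.
  by have [-> ->] := einj _ _ _ _ kA kA' E.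
apply/subset_leq_card/subsetP => x /imsetP[[k c]]; rewrite !inE andbT => kA ->.
exact: eX.
Qed.

Lemma sub_terminals X X' A A' e : A' \subset A -> terminals X A e ->
  (forall k c, k \in A' -> e k c \in X') -> terminals X' A' e.
Proof.
move=> /subsetP AA [eX einj] H; split=> // k k' c c' /AA kA /AA kA'; exact: einj.
Qed.

Lemma linkage_set0 W X e : linkage W X set0 e.
Proof. by exists (fun=> set0); split=> k; rewrite ?inE // => ?; rewrite inE. Qed.

Lemma linkable1 : linkable 1.
Proof.
move=> D v X A e /eqP/cards1P[i ->] Xv cX tA _; have [eX einj] := tA.
have A1 : #|A| <= 1 by have := leq_terminals tA; lia.
have [->|[k kA]] := set_0Vmem A; first exact: linkage_set0.
have only k' : k' \in A -> k' = k by move=> kA'; apply: (card_le1_eqP A1).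
have ev c : e k c \in subcube [set i] v by apply: (subsetP Xv); apply: eX.
have ea : adj (e k false) (e k true).
  apply/existsP; exists i; apply/eqP/ffunP => j; rewrite ffunE.
  case: eqVneq => [->|ji]; last first.
    by have /subcubeP E := ev true; have /subcubeP E' := ev false; rewrite addbF E ?E' ?inE.
  rewrite addbT; apply/eqP; apply: contraT => H.
  have [|] // := einj k k false true kA kA.
  apply/ffunP => l; have [->|li] := eqVneq l i.
    by move: H; case: (e k false i) (e k true i) => [] [].
  by have /subcubeP E := ev true; have /subcubeP E' := ev false; rewrite E ?E' ?inE.
exists (fun=> [set e k false; e k true]); split.
- by move=> ? _; rewrite subUset !sub1set !ev.
- by move=> _ /only ->; apply: linked_adj => //; rewrite !inE eqxx ?orbT.
- move=> _ x /only -> + _; rewrite !inE => /orP[/eqP->|/eqP->]; by [exists false|exists true].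
- by move=> ? ? /only -> /only ->; rewrite eqxx.
Qed.

(** * The induction step *)

(** Half [b] receives as marked vertices [side b] and one projected terminal per separated pair
    completed there. The induction allows [m.+1] of them, which leaves a capacity of
    [m.+1 - #|side b|] separated pairs. *)
Lemma linkage_across m D v X A e i x0 : linkable m -> 0 < m ->
  #|D| = m.+1 -> X \subset subcube D v -> #|X| <= m.+2 -> terminals X A e ->
  #|A| <= 1 \/ 4 <= m -> i \in D ->
  (forall u, u \in X -> flip i u \in X -> x0 = u \/ x0 = flip i u) ->
  (forall b, exists2 u, u \in X & u i = b) ->
  linkage (subcube D v) X A e.
Proof.
move=> IH m0 cD Xv cX tA Am iD x0P Xside; have [eX einj] := tA.
pose side (b : bool) : {set V} := [set u in X | u i == b].
have cside b : #|X| = #|side b| + #|side (~~ b)|.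
  rewrite -(cardsID (side b) X); congr (_ + _); apply: eq_card => u.
    by rewrite !inE andbA andbb.
  by rewrite !inE; case: (u \in X) => //=; case: (u i) b => [] [].
have side0 b : 0 < #|side b|.
  by have [u uX ub] := Xside b; rewrite card_gt0; apply/set0Pn; exists u; rewrite inE uX ub /=.
(* Such a pair is joined by its own edge; projecting along [i] would merge its two ends. *)
pose direct k := e k true == flip i (e k false).
pose Sp : {set K} := [set k in A | ~~ direct k & e k false i != e k true i].
have SA : Sp \subset A by apply/subsetP => k; rewrite inE => /and3P[].
(* Pairs of [F b] cannot be completed on the side [~~ b]. *)
pose F (b : bool) : {set K} :=
  [set k in Sp | [exists c, (e k c i == b) && (flip i (e k c) \in X)]].
have FS b : F b \subset Sp by apply/subsetP => k; rewrite inE => /andP[].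
(* The edge of [X] that blocks the pair contains [x0], so its end on side [b] is determined by [x0].
   Distinct pairs have distinct ends, whence [#|F b| <= 1]. *)
have Fx0 b k : k \in F b -> exists2 c, e k c i = b & e k c = upd i b x0.
  rewrite inE => /andP[kS /existsP[c /andP[/eqP eb fX]]]; exists c => //.
  have kA := subsetP SA _ kS.
  case: (x0P _ (eX _ c kA) fX) => ->; first by rewrite upd_id.
  rewrite upd_flip ?flipK // flip_i eb; by case: (b).
have F1 b : #|F b| <= 1.
  apply/card_le1_eqP => k k' kF kF'.
  have [c _ E] := Fx0 _ _ kF; have [c' _ E'] := Fx0 _ _ kF'.
  have kA : k \in A by apply: (subsetP SA); apply: (subsetP (FS b)).
  have kA' : k' \in A by apply: (subsetP SA); apply: (subsetP (FS b)).
  by have [|] := einj k k' c c' kA kA'; rewrite ?E ?E'.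
(* A pair blocked on both sides would have the two ends of the edge at [x0] as terminals, and so
   would be direct. *)
have dF : [disjoint F false & F true].
  apply/pred0P => k /=; apply/negP => /andP[kF kF'].
  have [c cb E] := Fx0 _ _ kF; have [c' cb' E'] := Fx0 _ _ kF'.
  move: kF; rewrite !inE => /andP[/and3P[_ /negP nd _] _]; apply: nd.
  have fE : e k c' = flip i (e k c).
    by rewrite E E'; apply/ffunP => j; rewrite !ffunE; case: eqP => //=; rewrite addbF.
  rewrite /direct; case: c c' cb cb' E E' fE => [] [] // cb cb' E E' fE.
  - by rewrite cb in cb'.
  - by rewrite fE flipK.
  - by rewrite fE.
  - by rewrite cb in cb'.
(* If [F b] contains a pair, side [~~ b] holds its far terminal and the flip of its near one. These
   differ because the pair is not direct, so [#|side b| <= m] and there is room for one pair. *)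
have Fd b : #|F b| <= m.+1 - #|side b|.
  have := cside b; have := side0 (~~ b) => s0 cs.
  have [F0|[k kF]] := set_0Vmem (F b); first by rewrite F0 cards0.
  have := F1 b; suff : 1 < #|side (~~ b)| by lia.
  have [c cb _] := Fx0 _ _ kF.
  move: kF; rewrite !inE => /andP[/and3P[kA nd ns] /existsP[c' /andP[/eqP cb' fX]]].
  have cc : c' = c by clear fX; case: c c' cb cb' ns => [] [] // -> ->; rewrite eqxx.
  subst c'; apply/card_gt1P; exists (flip i (e k c)), (e k (~~ c)); split.
  - by rewrite inE fX flip_i cb eqxx.
  - by rewrite inE eX //= -cb; case: (c) ns => /=; case: (e k false i) (e k true i) => [] [].
  - apply: contra nd; rewrite /direct; case: (c) => /eqP E; last by rewrite E.
    by rewrite -E flipK.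
(* Both sides are nonempty, so neither subtraction truncates and the total capacity is at least [m].
   Either [#|Sp| <= 1], or [4 <= m] and [#|Sp|] is at most half of [m.+2]. *)
have cS : #|Sp| <= (m.+1 - #|side false|) + (m.+1 - #|side true|).
  have tS : terminals X Sp e.
    by apply: (sub_terminals SA tA) => k c kS; apply: eX; apply: (subsetP SA).
  have := leq_terminals tS; have := cside true; have := side0 true; have := side0 false.
  have := subset_leq_card SA; move: m0 cX Am => /=.
  by move: #|Sp| #|A| #|X| #|side _| #|side _|; lia.
have [T [FT TS dT cT0 cT1]] := set_split (FS false) (FS true) dF (Fd false) (Fd true) cS.
(* The side on which pair [k] is completed: [T] collects the separated pairs sent to side [true]. *)
pose sg k := if k \in Sp then k \in T else e k false i.
pose Ab (b : bool) : {set K} := [set k in A | ~~ direct k & sg k == b].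
(* A projected terminal that lands in [X] was already on its side. *)
have proj_id k c : k \in A -> ~~ direct k -> upd i (sg k) (e k c) \in X ->
    upd i (sg k) (e k c) = e k c.
  move=> kA nd uX; have [cb|cb] := eqVneq (e k c i) (sg k); first exact: upd_id.
  have fX : flip i (e k c) \in X by rewrite -(upd_flip cb).
  case: (boolP (k \in Sp)) => kS.
    have kF : k \in F (e k c i) by rewrite inE kS /=; apply/existsP; exists c; rewrite eqxx.
    move: cb kF; rewrite /sg kS; case: (e k c i) => cb kF.
      by move: cb; rewrite (subsetP FT _ kF).
    by move: cb; rewrite (disjointFr dT kF).
  move: cb; rewrite /sg (negPf kS); move: kS; rewrite inE kA nd /= negbK => /eqP E.
  by case: (c); rewrite ?E eqxx.
have Hb b : linkage (subcube (D :\ i) (upd i b v))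
    (side b :|: [set upd i b (e p.1 p.2) | p in setX (Ab b) [set: bool]])
    (Ab b) (fun k c => upd i b (e k c)).
  have AbA : Ab b \subset A by apply/subsetP => k; rewrite inE => /andP[].
  apply: IH.
  - by have := cardsD1 i D; rewrite iD cD; lia.
  - apply/subsetP => u; rewrite mem_side // => /setUP[|/imsetP[[k c]]].
      by rewrite inE => /andP[uX ->]; rewrite (subsetP Xv).
    rewrite in_setX in_setT andbT /= => /(subsetP AbA) kA ->; rewrite upd_i eqxx andbT.
    have ev : e k c \in subcube D v by apply: (subsetP Xv); apply: eX.
    have [/upd_id ->//|/upd_flip ->] := eqVneq (e k c i) b.
    by rewrite flip_subcube.
  (* Only the far end of a separated pair adds a marked vertex. That end is
     [e k (e k false i == b)]: its index is [true] exactly when the end [false] lies on side [b]. *)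
  - have sub : side b :|: [set upd i b (e p.1 p.2) | p in setX (Ab b) [set: bool]]
       \subset side b :|: [set upd i b (e k (e k false i == b)) | k in Ab b :&: Sp].
      apply/subsetP => u /setUP[us|/imsetP[[k c]]]; first by rewrite inE us.
      rewrite in_setX => /andP[/= kb _] uE.
      have kA := subsetP AbA _ kb.
      have [cb|cb] := eqVneq (e k c i) b.
        by rewrite uE upd_id // in_setU inE eX // cb eqxx.
      have kS : k \in Sp.
        apply: contraNT cb => kS; move: kb; rewrite inE kA /sg (negPf kS) /= => /andP[nd /eqP <-].
        by move: kS; rewrite inE kA nd negbK /= => /eqP E; case: (c); rewrite ?E.
      rewrite in_setU orbC uE; apply/orP; left; apply/imsetP; exists k; first by rewrite inE kb.
      congr upd; congr e; move: kS cb; rewrite inE => /and3P[_ _].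
      by case: c {uE} => /=; case: (e k false i) (e k true i) (b) => [] [] [].
    apply: leq_trans (subset_leq_card sub) _.
    apply: leq_trans (leq_card_setU _ _).1 _.
    have le : #|[set upd i b (e k (e k false i == b)) | k in Ab b :&: Sp]| <= m.+1 - #|side b|.
      apply: leq_trans (leq_imset_card _ _) _.
      have : Ab b :&: Sp \subset if b then T else Sp :\: T.
        apply/subsetP => k; rewrite in_setI => /andP[+ kS].
        rewrite inE /sg kS => /and3P[_ _ /eqP]; by case: (b) => kT; rewrite ?in_setD kT // kS.
      by move/subset_leq_card => le; apply: (leq_trans le); case: (b).
    apply: leq_trans (leq_add (leqnn _) le) _.
    by move: (cside b) (side0 (~~ b)) cX; move: #|side b| #|side _| #|X|; lia.
  - split=> [k c kb|k k' c c' kb kb' E].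
      by rewrite inE; apply/orP; right; apply/imsetP; exists (k, c); rewrite // in_setX kb inE.
    have [kA kA'] := (subsetP AbA _ kb, subsetP AbA _ kb').
    move: kb kb'; rewrite !inE => /and3P[_ nd /eqP sk] /and3P[_ nd' /eqP sk'].
    apply: einj => //.
    have pk := proj_id _ c kA nd; have pk' := proj_id _ c' kA' nd'.
    rewrite sk sk' in pk pk'.
    have [cb|cb] := eqVneq (e k c i) b.
      by rewrite -pk' -E (upd_id cb) // eX.
    have [cb'|cb'] := eqVneq (e k' c' i) b.
      by rewrite -pk E (upd_id cb') // eX.
    by move: E; rewrite !upd_flip // => /(can_inj (@flipK i)).
  - by have := subset_leq_card AbA; lia.
have [C0 [C0s C0l C0X C0d]] := Hb false; have [C1 [C1s C1l C1X C1d]] := Hb true.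
pose C b := if b then C1 else C0.
have Cs b k : k \in Ab b -> C b k \subset subcube (D :\ i) (upd i b v).
  by case: b => [/C1s|/C0s].
have Cl b k : k \in Ab b -> linked (C b k) (upd i b (e k false)) (upd i b (e k true)).
  by case: b => [/C1l|/C0l].
have Cd b k k' : k \in Ab b -> k' \in Ab b -> k != k' -> [disjoint C b k & C b k'].
  by case: b; [apply: C1d|apply: C0d].
have Csd b k u : k \in Ab b -> u \in C b k -> (u \in subcube D v) && (u i == b).
  by move=> kb uC; rewrite -mem_side //; apply: (subsetP (Cs b k kb)).
have CX b k u : k \in Ab b -> u \in C b k -> u \in X -> exists c, u = e k c.
  move=> kb uC uX; have /andP[_ ub] := Csd _ _ _ kb uC.
  have us : u \in side b by rewrite inE uX.
  have [c uE] : exists c, u = upd i b (e k c).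
    case: b {ub} kb uC us => kb uC us; [apply: (C1X _ _ kb uC)|apply: (C0X _ _ kb uC)];
      by rewrite inE us.
  move: kb; rewrite inE => /and3P[kA nd /eqP sk]; exists c.
  by rewrite uE -sk proj_id // sk -uE.
have Abs k : k \in A -> ~~ direct k -> k \in Ab (sg k) by move=> kA nd; rewrite inE kA nd eqxx.
pose E k := if direct k then set0 else C (sg k) k.
have EX k u : k \in A -> u \in E k -> u \in X -> exists c, u = e k c.
  rewrite /E => kA; case: ifP => [_|/negbT nd]; first by rewrite inE.
  by apply: CX; apply: Abs.
have Ed k k' : k \in A -> k' \in A -> k != k' -> [disjoint E k & E k'].
  rewrite /E => kA kA' kk.
  case: ifP => [_|/negbT nd]; first by rewrite -setI_eq0 set0I.
  case: ifP => [_|/negbT nd']; first by rewrite -setI_eq0 setI0.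
  have [ss|ss] := eqVneq (sg k) (sg k').
    by rewrite -ss; apply: Cd => //; [exact: Abs|rewrite ss; apply: Abs].
  apply/pred0P => u /=; apply/negP => /andP[uC uC'].
  have /andP[_ /eqP uk] := Csd _ _ _ (Abs _ kA nd) uC.
  have /andP[_ /eqP uk'] := Csd _ _ _ (Abs _ kA' nd') uC'.
  by rewrite -uk uk' eqxx in ss.
exists (fun k => E k :|: [set e k false; e k true]); split.
- move=> k kA; rewrite subUset; apply/andP; split.
    rewrite /E; case: ifP => [_|/negbT nd]; first exact: sub0set.
    by apply/subsetP => u /(Csd _ _ _ (Abs _ kA nd)) /andP[].
  by rewrite subUset !sub1set !(subsetP Xv) // eX.
- move=> k kA; set Ck := _ :|: _.
  have ek c : e k c \in Ck by rewrite !inE; case: c; rewrite eqxx ?orbT.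
  have [dk|nd] := boolP (direct k).
    by apply: linked_adj => //; move/eqP: dk => ->; apply: adj_flip.
  have kb := Abs _ kA nd.
  have CCk : C (sg k) k \subset Ck by rewrite /Ck /E (negPf nd) subsetUl.
  have lk := linkedS CCk (Cl _ _ kb).
  have pk c : linked Ck (e k c) (upd i (sg k) (e k c)).
    have [cb|cb] := eqVneq (e k c i) (sg k); first by rewrite upd_id // linked_refl.
    have /and3P[uf ut _] := lk.
    apply: linked_adj => //; first by rewrite upd_flip // adj_flip.
    by case: (c).
  apply: linked_trans (pk false) _; apply: linked_trans lk _.
  by rewrite linked_sym.
- move=> k x kA /setUP[xE xX|]; first exact: EX xE xX.
  by rewrite !inE => /orP[/eqP->|/eqP->] _; [exists false|exists true].
- move=> k k' kA kA' kk; apply/pred0P => u /=; apply/negP.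
  have ekX k1 : k1 \in A -> u \in [set e k1 false; e k1 true] -> exists2 c, u = e k1 c & u \in X.
    move=> kA1; rewrite !inE => /orP[/eqP->|/eqP->]; [exists false|exists true] => //; exact: eX.
  have no c c' : e k c <> e k' c' by move=> /(einj _ _ _ _ kA kA')[] /eqP; rewrite (negPf kk).
  case/andP=> /setUP[uE|/(ekX _ kA)[c uE uX]] /setUP[uE'|/(ekX _ kA')[c' uE' uX']].
  + by have /pred0P/(_ u) := Ed _ _ kA kA' kk; rewrite /= uE uE'.
  + have [c uc] := EX _ _ kA uE uX'; by apply: (no c c'); congruence.
  + have [c' uc] := EX _ _ kA' uE' uX; by apply: (no c c'); congruence.
  + by apply: (no c c'); rewrite -uE.
Qed.

Lemma flip_subcube_flip D v i u :
  (flip i u \in subcube D (flip i v)) = (u \in subcube D v).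
Proof.
by apply/subcubeP/subcubeP => H j /H; [rewrite !ffunE => /addIb|rewrite !ffunE => ->].
Qed.

(** Unmarking [t] brings the count down to [m.+1], at the price that a set [C k] may run through
    [t]. By disjointness this happens for at most one pair [k1], and then there are two pairs, so
    [4 <= m] and the opposite half can link two pairs. *)
Lemma linkage_one_side m D v X A e i : linkable m -> 0 < m ->
  #|D| = m.+1 -> i \in D -> X \subset subcube (D :\ i) v -> #|X| <= m.+2 ->
  terminals X A e -> #|A| <= 1 \/ 4 <= m -> linkage (subcube D v) X A e.
Proof.
move=> IH m0 cD iD Xv cX tA Am; have [eX einj] := tA.
have cD' : #|D :\ i| = m by have := cardsD1 i D; rewrite iD cD; lia.
have [->|[k0 k0A]] := set_0Vmem A; first exact: linkage_set0.
set s := e k0 false; set t := e k0 true.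
have st : s != t by apply/eqP => /(einj _ _ _ _ k0A k0A)[].
have k0X c : e k0 c \in X by apply: eX.
set W0 := subcube (D :\ i) v in Xv *; set W1 := subcube (D :\ i) (flip i v).
have W01 u : u \in W0 -> u \in W1 -> False.
  move=> /subcubeP/(_ i); rewrite setD11 => /(_ isT) u0 /subcubeP/(_ i).
  by rewrite setD11 flip_i u0 => /(_ isT); case: (v i).
have W0D : W0 \subset subcube D v.
  by apply/subsetP => u /subcubeP H; apply/subcubeP => j jD; rewrite H // inE (negPf jD) andbF.
have W1D : W1 \subset subcube D v.
  apply/subsetP => u uW; rewrite -(flip_subcube _ _ iD); apply: (subsetP W0D).
  by rewrite /W0 -(flip_subcube_flip _ _ i) flipK.
set A1 := A :\ k0; have A1A : A1 \subset A by apply: subsetDl.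
have A1P k : k \in A -> k != k0 -> k \in A1 by move=> kA kk; rewrite in_setD1 kk.
have [C [Cs Cl CX Cd]] : linkage W0 (X :\ t) A1 e.
  apply: IH => //.
  - by apply: subset_trans (subsetDl _ _) Xv.
  - by rewrite (cardsD1 t) k0X in cX.
  - apply: (sub_terminals A1A tA) => k c; rewrite in_setD1 => /andP[kk kA].
    by rewrite in_setD1 eX // andbT; apply: contra kk => /eqP/(einj _ _ _ _ kA k0A)[->].
  - by case: Am => Am; [left; apply: leq_trans (subset_leq_card A1A) Am|right].
(* [s] is still marked but belongs to none of the pairs of [A1]. *)
have sC k : k \in A1 -> s \notin C k.
  move=> kA1; apply/negP => sk; have [|c sE] := CX _ _ kA1 sk; first by rewrite in_setD1 st k0X.
  move: kA1; rewrite in_setD1 => /andP[/eqP kk kA]; apply: kk.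
  by have [] := einj _ _ _ _ k0A kA sE.
(* The sets [E k] are the parts in the opposite half [W1], which contains no vertex of [X]. Pair
   [k0] keeps only [s] and [t] in [W0]; every other pair gives up [t]. *)
have glue (E : K -> {set V}) : (forall k, E k \subset W1) -> linked (E k0) (flip i s) (flip i t) ->
    (forall k, k \in A1 -> linked ((C k :\ t) :|: E k) (e k false) (e k true)) ->
    (forall k k', k \in A -> k' \in A -> k != k' -> [disjoint E k & E k']) ->
    linkage (subcube D v) X A e.
  move=> Es El0 El Ed.
  pose B k := if k == k0 then [set s; t] else C k :\ t.
  have Bs k : k \in A -> B k \subset W0.
    rewrite /B => kA; case: eqVneq => [_|kk].
      by rewrite subUset !sub1set; apply/andP; split; apply: (subsetP Xv); apply: k0X.
    exact: (subset_trans (subsetDl _ _) (Cs _ (A1P _ kA kk))).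
  exists (fun k => B k :|: E k); split.
  - move=> k kA; rewrite subUset (subset_trans (Bs k kA) W0D).
    exact: subset_trans (Es k) W1D.
  - move=> k kA; rewrite /B; case: eqVneq => [->|kk]; last by apply: El; apply: A1P.
    rewrite -/s -/t; set Ck := _ :|: _.
    have El' : linked Ck (flip i s) (flip i t) by apply: linkedS El0; apply: subsetUr.
    have up x : x \in Ck -> flip i x \in Ck -> linked Ck x (flip i x).
      by move=> xC fC; apply: linked_adj => //; apply: adj_flip.
    have /and3P[fs ft _] := El'.
    apply: (linked_trans (up s _ fs)); first by rewrite !inE eqxx.
    apply: (linked_trans El'); rewrite linked_sym; apply: up ft.
    by rewrite !inE eqxx orbT.
  - move=> k x kA /setUP[] xB xX; last first.
      by case: (W01 x); [apply: (subsetP Xv)|apply: (subsetP (Es k))].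
    move: xB; rewrite /B; case: eqVneq => [->|kk].
      by rewrite !inE => /orP[]/eqP->; [exists false|exists true].
    by rewrite in_setD1 => /andP[xt xC]; apply: (CX _ _ (A1P _ kA kk) xC); rewrite in_setD1 xt.
  - move=> k k' kA kA' kk; apply/pred0P => u /=; apply/negP => /andP[].
    case/setUP=> uB /setUP[] uB'.
    + move: uB uB'; rewrite /B; case: eqVneq => [kE|k1]; case: eqVneq => [kE'|k1'].
      * by rewrite kE kE' eqxx in kk.
      * by rewrite in_set2 in_setD1 => /orP[]/eqP->; rewrite ?eqxx //
          (negPf (sC _ (A1P _ kA' k1'))) andbF.
      * by rewrite in_set2 in_setD1 => + /orP[]/eqP uE; rewrite uE ?eqxx //
          (negPf (sC _ (A1P _ kA k1))) andbF.
      * rewrite !in_setD1 => /andP[_ uC] /andP[_ uC'].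
        have /pred0P/(_ u) := Cd _ _ (A1P _ kA k1) (A1P _ kA' k1') kk.
        by rewrite /= uC uC'.
    + by case: (W01 u); [apply: (subsetP (Bs k kA))|apply: (subsetP (Es k'))].
    + by case: (W01 u); [apply: (subsetP (Bs k' kA'))|apply: (subsetP (Es k))].
    + by have /pred0P/(_ u) := Ed _ _ kA kA' kk; rewrite /= uB uB'.
(* Induction in [W1], where the flipped ends of the pairs are the only marked vertices. *)
have opposite A' e' :
    (forall k c, k \in A' -> e' k c \in W0) ->
    (forall k k' c c', k \in A' -> k' \in A' -> e' k c = e' k' c' -> k = k' /\ c = c') ->
    #|A'| * 2 <= m.+1 -> #|A'| <= 1 \/ 4 <= m ->
    exists E : K -> {set V}, [/\ forall k, E k \subset W1,
      forall k, k \in A' -> linked (E k) (flip i (e' k false)) (flip i (e' k true)) &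
      forall k k', k != k' -> [disjoint E k & E k']].
  move=> eW einj' cA' Am'.
  have [|||E [Es El _ Ed]] := IH (D :\ i) (flip i v)
    [set flip i (e' p.1 p.2) | p in setX A' [set: bool]] A'
    (fun k c => flip i (e' k c)) cD' _ _ _ Am'.
  - apply/subsetP => u /imsetP[[k c]]; rewrite in_setX => /andP[/= kA' _] ->.
    by rewrite flip_subcube_flip; apply: eW.
  - by apply: leq_trans (leq_imset_card _ _) _; rewrite cardsX cardsT card_bool.
  - split=> [k c kA'|k k' c c' kA' kA2]; first by apply/imsetP; exists (k, c); rewrite // !inE kA'.
    by move=> /(can_inj (@flipK i)); apply: einj'.
  exists (fun k => if k \in A' then E k else set0); split=> [k|k kA'|k k' kk].
  - by case: ifP => [/Es|_]; rewrite ?sub0set.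
  - by rewrite kA'; apply: El.
  - case: ifP => [kA'|_]; last by rewrite -setI_eq0 set0I.
    by case: ifP => [kA2|_]; [apply: Ed|rewrite -setI_eq0 setI0].
have [/forall_inP Hl|] := boolP [forall k in A1, linked (C k :\ t) (e k false) (e k true)].
  have [k c|k k' c c'|||E [Es El Ed]] := opposite [set k0] e; rewrite ?in_set1 ?cards1 //.
  - by move/eqP->; apply: (subsetP Xv).
  - move=> /eqP-> /eqP->; exact: einj.
  - by left.
  apply: (glue E) => // [|k /Hl lk|k k' _ _]; last exact: Ed.
    by apply: El; rewrite inE.
  by apply: linkedS lk; apply: subsetUl.
rewrite negb_forall => /existsP[k1]; rewrite negb_imply => /andP[k1A1 nl].
have /andP[k10 k1A] : (k1 != k0) && (k1 \in A) by rewrite -in_setD1.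
have tC : t \in C k1.
  apply: contraNT nl => tC; apply: linkedS (Cl _ k1A1).
  by apply/subsetP => u uC; rewrite in_setD1 uC andbT; apply: contraNneq tC => <-.
have [||a [b [ab at_ tb la lb]]] := linked_detour (Cl _ k1A1) _ _ nl.
- by apply/eqP => /(einj _ _ _ _ k0A k1A)[k01]; rewrite k01 eqxx in k10.
- by apply/eqP => /(einj _ _ _ _ k0A k1A)[k01]; rewrite k01 eqxx in k10.
have /and3P[_ + _] := la; rewrite in_setD1 => /andP[at' aC].
have /and3P[+ _ _] := lb; rewrite in_setD1 => /andP[bt bC].
have m4 : 3 < m.
  case: Am => // A1'; have : 1 < #|A| by apply/card_gt1P; exists k0, k1; rewrite eq_sym.
  by rewrite ltnNge A1'.
(* The two pairs to be linked through [W1] after flipping: [s] with [t], and the neighbours [a], [b]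
   of [t] on the path of [k1]. *)
pose e' k c := if k == k0 then e k0 c else if c then b else a.
have e'0 c : e' k0 c = e k0 c by rewrite /e' eqxx.
have e'1 c : e' k1 c = if c then b else a by rewrite /e' (negPf k10).
have c2 : #|[set k0; k1]| = 2 by rewrite cards2 eq_sym k10.
have no01 c c' : e k0 c <> if c' then b else a.
  case: c; rewrite -/s -/t; case: c' => E; move: (sC _ k1A1) at' bt; rewrite E ?eqxx //.
    by rewrite bC.
  by rewrite aC.
have [k c|k k' c c'|||E [Es El Ed]] := opposite [set k0; k1] e'; rewrite ?in_set2 ?eqxx //.
- case/orP=> /eqP->; first by rewrite e'0; apply: (subsetP Xv).
  by rewrite e'1; apply: (subsetP (Cs _ k1A1)); case: c.
- move=> /orP[]/eqP-> /orP[]/eqP->; rewrite ?e'0 ?e'1.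
  + exact: einj.
  + by move/no01.
  + by move/esym/no01.
  + by case: c c' => [] [] // E; move: ab; rewrite E eqxx.
- by rewrite c2 -[_ * 2]/(3.+1) ltnS ltnW.
- by right.
apply: (glue E) => // [|k kA1|k k' _ _]; last exact: Ed.
  by have := El k0; rewrite !e'0 in_set2 eqxx; apply.
have [->|kk1] := eqVneq k k1; last first.
  apply: linkedS (Cl _ kA1); apply/subsetP => u uC; rewrite in_setU in_setD1 uC andbT.
  have /pred0P/(_ t) := Cd _ _ kA1 k1A1 kk1; rewrite /= tC andbT => tCk.
  by case: eqVneq uC tCk => [->->|].
have lE : linked (E k1) (flip i a) (flip i b).
  by have := El k1; rewrite !e'1 in_set2 eqxx orbT; apply.
set U := _ :|: _.
have CU : C k1 :\ t \subset U by apply: subsetUl.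
have {}lE : linked U (flip i a) (flip i b) by apply: linkedS lE; apply: subsetUr.
have {}la := linkedS CU la; have {}lb := linkedS CU lb.
have /and3P[fa fb _] := lE; have /and3P[_ aU _] := la; have /and3P[bU _ _] := lb.
apply: (linked_trans la); apply: (linked_trans (linked_adj (adj_flip i a) aU fa)).
apply: (linked_trans lE); apply: linked_trans lb; rewrite linked_sym.
exact: linked_adj (adj_flip i b) bU fb.
Qed.

(** * Two pairs in the 4-cube *)

Section CodeCube.
Variables (D : {set I}) (v : V).
Hypothesis D4 : #|D| = 4.

(** Coordinates relative to [v], so that [v] gets the zero code. For [j] outside [D] the index is 4,
    and on a code of length 4 the default [false] leaves [v j] unchanged. *)
Definition of_code (c : code) : V := [ffun j => v j (+) nth false c (index j (enum D))].
Definition to_code (u : V) : code := [seq v j (+) u j | j <- enum D].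

Lemma size_to_code u : size (to_code u) = 4.
Proof. by rewrite size_map -cardE. Qed.

Lemma to_codeK u : u \in subcube D v -> of_code (to_code u) = u.
Proof.
move/subcubeP => uD; apply/ffunP => j; rewrite ffunE.
have [jD|jD] := boolP (j \in D).
  by rewrite (nth_map j) ?index_mem ?mem_enum // nth_index ?mem_enum // addKb.
by rewrite nth_default ?addbF ?uD // size_map memNindex ?mem_enum.
Qed.

Lemma of_codeK (c : code) : size c = 4 -> to_code (of_code c) = c.
Proof.
move=> c4; have sD : size (enum D) = 4 by rewrite -cardE.
apply: (@eq_from_nth _ false) => [|m]; rewrite size_to_code ?c4 // => m4.
have [j0 _] : exists j0, j0 \in D by apply/set0Pn; rewrite -card_gt0 D4.
by rewrite (nth_map j0) ?sD // ffunE addKb index_uniq ?sD ?enum_uniq.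
Qed.

Lemma of_code_subcube (c : code) : size c = 4 -> of_code c \in subcube D v.
Proof.
move=> c4; apply/subcubeP => j jD.
by rewrite ffunE nth_default ?addbF // c4 memNindex ?mem_enum // -cardE D4.
Qed.

Lemma of_code0 : of_code (nseq 4 false) = v.
Proof. by apply/ffunP => j; rewrite ffunE nth_nseq if_same addbF. Qed.

Lemma of_code_adj (c c' : code) : c' \in code_nbrs c -> adj (of_code c) (of_code c').
Proof.
case/mapP=> m; rewrite mem_iota => /andP[_ m4] ->.
have sD : size (enum D) = 4 by rewrite -cardE.
have [j0 _] : exists j0, j0 \in D by apply/set0Pn; rewrite -card_gt0 D4.
apply/existsP; exists (nth j0 (enum D) m); apply/eqP/ffunP => j.
rewrite !ffunE nth_set_nth /=.
have -> : (index j (enum D) == m) = (j == nth j0 (enum D) m).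
  apply/eqP/eqP => [mE|->]; last by rewrite index_uniq ?sD ?enum_uniq.
  by rewrite -mE nth_index // -index_mem sD mE.
case: eqP => [->|_]; last by rewrite addbF.
by rewrite index_uniq ?sD ?enum_uniq // addbT addbN.
Qed.

Lemma linked_of_code (P : seq code) (x : code) p : size x = 4 ->
  path (fun c c' : code => c' \in code_nbrs c) x p -> {subset x :: p <= P} ->
  all (fun c : code => size c == 4) (x :: p) ->
  linked [set u in subcube D v | to_code u \in P] (of_code x) (of_code (last x p)).
Proof.
set C := [set u in _ | _] => x4.
have inC (c : code) : c \in P -> size c = 4 -> of_code c \in C.
  by move=> cP c4; rewrite inE of_codeK // cP of_code_subcube.
elim: p x x4 => [|z p IHp] x x4 /=.
  by move=> _ sP _; apply/linked_refl/inC => //; apply: sP; rewrite inE.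
move=> /andP[xz pp] sP /and3P[_ /eqP z4 p4].
have xP := sP x (mem_head _ _); have zP : z \in P by apply: sP; rewrite !inE eqxx orbT.
have la := linked_adj (of_code_adj xz) (inC x xP x4) (inC z zP z4).
apply: (linked_trans la); apply: IHp => //=; last by rewrite z4.
by move=> c cp; apply: sP; rewrite inE cp orbT.
Qed.

End CodeCube.

(** Five vertices hold at most two pairs, and two pairs leave at most one further vertex. With [s1]
    as base point this is the situation of [code_check]. *)
Lemma linkage4 D v X A e : #|D| = 4 -> X \subset subcube D v -> #|X| <= 5 ->
  terminals X A e -> 1 < #|A| -> linkage (subcube D v) X A e.
Proof.
move=> D4 Xv cX tA A1; have [eX einj] := tA.
have /cards2P[k1 [k2 [k12 AE]]] : #|A| == 2 by move: (leq_terminals tA) cX A1; move: #|A| #|X|; lia.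
have k21 : (k2 == k1) = false by rewrite eq_sym (negPf k12).
have k1A : k1 \in A by rewrite AE !inE eqxx.
have k2A : k2 \in A by rewrite AE !inE eqxx orbT.
have ev k c : k \in A -> e k c \in subcube D v by move=> kA; apply: (subsetP Xv); apply: eX.
pose s1 := e k1 false; pose t1 := e k1 true; pose s2 := e k2 false; pose t2 := e k2 true.
have Ds1 : subcube D s1 = subcube D v by apply: eq_subcube; apply: ev.
rewrite -Ds1; rewrite -Ds1 in Xv ev.
have neq k k' c c' : k \in A -> k' \in A -> (k != k') || (c != c') -> e k c != e k' c'.
  by move=> kA kA'; apply: contraTneq => /(einj _ _ _ _ kA kA')[-> ->]; rewrite !eqxx.
have un : uniq [:: s1; t1; s2; t2].
  by rewrite /= !inE !negb_or !neq ?k12 ?orbT.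
pose T := [set s1; t1; s2; t2].
have TX : T \subset X by rewrite !subUset !sub1set !eX.
have cT : #|T| = 4.
  have -> : T = [set x in [:: s1; t1; s2; t2]] by apply/setP => x; rewrite !inE !orbA.
  by rewrite cardsE (card_uniqP un).
(* Without a fifth vertex, [o] is set to the terminal [s1], where the check imposes nothing. *)
have [o XT] : exists o, forall x, x \in X -> x \notin T -> x = o.
  have XT1 : #|X :\: T| <= 1 by rewrite cardsD (setIidPr TX) cT leq_subLR.
  have [XT0|[o oXT]] := set_0Vmem (X :\: T).
    exists s1 => x xX xT; by move/setP/(_ x): XT0; rewrite in_setD xX xT inE.
  by exists o => x xX xT; apply: (card_le1_eqP XT1) => //; rewrite in_setD xX xT.
pose f := to_code D s1; pose g := of_code D s1.
have fK x : x \in subcube D s1 -> g (f x) = x by apply: to_codeK.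
have f_inj x y : x \in X -> y \in X -> (f x == f y) = (x == y).
  move=> xX yX; apply/eqP/eqP => [E|->] //.
  by rewrite -(fK x) ?(subsetP Xv) // E fK // (subsetP Xv).
have fsz x : size (f x) = 4 by apply: size_to_code.
have fs1 : f s1 = nseq 4 false by rewrite -(of_code0 D s1) /f of_codeK // size_nseq.
have mem4 x : x \in X -> (f x \in [:: f s1; f t1; f s2; f t2]) = (x \in T).
  by move=> xX; rewrite !inE !f_inj ?orbA //; apply: eX.
have unf : uniq [:: nseq 4 false; f t1; f s2; f t2].
  by move: un; rewrite -fs1 /= !inE !f_inj //; apply: eX.
have [p [q [pP qP pq pqo]]] := code_pathsP (fsz t1) (fsz s2) (fsz t2) (fsz o) unf.
have [p' [pE pp pl p4]] := code_walksP pP (size_nseq _ _).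
have [q' [qE qp ql q4]] := code_walksP qP (fsz s2).
pose Cp (r : seq code) : {set V} := [set u in subcube D s1 | f u \in r].
have lp : linked (Cp p) s1 t1.
  have := linked_of_code s1 D4 (size_nseq 4 false) pp _ _ (P := p).
  rewrite -pE pl -/g -fs1 !fK ?subcube_refl ?ev //; exact.
have lq : linked (Cp q) s2 t2.
  have := linked_of_code s1 D4 (fsz s2) qp _ _ (P := q).
  rewrite -qE ql -/g !fK ?ev //; exact.
have hit r x : x \in Cp r -> f x \in r by rewrite inE => /andP[].
have hd_p : f s1 \in p by rewrite pE fs1 mem_head.
have hd_q : f s2 \in q by rewrite qE mem_head.
have tl_p : f t1 \in p by rewrite pE -pl mem_last.
have tl_q : f t2 \in q by rewrite qE -ql mem_last.
have dpq (c : code) : c \in p -> c \in q -> False.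
  by move=> cp cq; move/hasPn: pq => /(_ c cq); rewrite /= cp.
have noo x : x \in X -> x \notin T -> f x \in p \/ f x \in q -> False.
  move=> xX xT; have xo := XT x xX xT; subst o.
  by move: pqo; rewrite -fs1 mem4 // => /(_ xT)/andP[/negPf-> /negPf->] [].
exists (fun k => if k == k1 then Cp p else Cp q); split.
- move=> k _; apply/subsetP => u; case: ifP => _; rewrite inE => /andP[] //.
- by move=> k; rewrite AE in_set2 => /orP[]/eqP->; rewrite ?eqxx ?k21.
- move=> k x; rewrite AE in_set2 => /orP[]/eqP->; rewrite ?eqxx ?k21 => /hit xr xX.
  + have [xT|xT] := boolP (x \in T); last by case: (noo x xX xT); left.
    move: xT xr; rewrite !inE -!orbA => /or4P[]/eqP->.
    * by exists false.
    * by exists true.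
    * by move=> sp; case: (dpq _ sp hd_q).
    * by move=> sp; case: (dpq _ sp tl_q).
  + have [xT|xT] := boolP (x \in T); last by case: (noo x xX xT); right.
    move: xT xr; rewrite !inE -!orbA => /or4P[]/eqP->.
    * by move=> /(dpq _ hd_p).
    * by move=> /(dpq _ tl_p).
    * by exists false.
    * by exists true.
- have dis : [disjoint Cp p & Cp q].
    by apply/pred0P => u /=; apply/negP => /andP[/hit up /hit]; apply: dpq up.
  move=> k k'; rewrite AE !in_set2 => /orP[]/eqP-> /orP[]/eqP->; rewrite ?eqxx ?k21 //.
  by rewrite disjoint_sym.
Qed.

Lemma linkable_all m : 0 < m -> linkable m.
Proof.
elim: m => // m IHm _; have [->|m0] := posnP m; first exact: linkable1.
have {}IHm := IHm m0; move=> D v X A e cD Xv cX tA Am.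
have [eX einj] := tA.
have [->|[k0 k0A]] := set_0Vmem A; first exact: linkage_set0.
(* The restriction on the number of pairs passes from dimension [m.+1] to [m] except for several
   pairs in dimension 4. *)
have [[m3 A1]|Am'] : (m = 3 /\ 1 < #|A|) \/ (#|A| <= 1 \/ 4 <= m).
- by move: Am; move: #|A|; lia.
- by subst m; apply: linkage4.
have xX := eX k0 false k0A.
have D0 : D != set0 by rewrite -card_gt0 cD.
have [|i iD x0P] := exists_sparse_direction D0 xX; first by rewrite cD.
have [/forallP Hb|] := boolP [forall b, [exists u in X, u i == b]].
  apply: (linkage_across (x0 := e k0 false) IHm m0 cD Xv cX tA Am' iD x0P) => b.
  by have /exists_inP[u uX /eqP ub] := Hb b; exists u.
rewrite negb_forall => /existsP[b]; rewrite negb_exists => /forallP Hb.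
have vD : upd i (~~ b) v \in subcube D v.
  by apply/subcubeP => j jD; rewrite ffunE; case: eqP => // jE; rewrite jE iD in jD.
rewrite -(eq_subcube vD); apply: (linkage_one_side IHm m0 cD iD _ cX tA Am').
apply/subsetP => u uX; rewrite mem_side // (subsetP Xv) //=.
by move: (Hb u); rewrite uX /=; case: (u i) (b) => [] [].
Qed.

End Hypercube.

(** * The geometric cube *)

From mathcomp Require Import boolp classical_sets functions cardinality.
From mathcomp Require Import convex interval_inference lra.

Import Order.TTheory GRing.Theory Num.Theory.

Local Open Scope classical_set_scope.
Local Open Scope ring_scope.

Section Cube.
Variables (R : realType) (d : nat).
Local Notation Q := (@cube R d).
Local Notation V := {ffun 'I_d -> bool}.
Implicit Types (x y c : 'rV[R]_d) (u w : V).

Lemma convexP (A : set 'rV[R]_d) :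
  convex_set A <-> (forall x y (t : R), A x -> A y -> 0 <= t <= 1 ->
    A (t *: x + (1 - t) *: y)).
Proof.
split=> [cA x y t Ax Ay /andP[t0 t1]|cA x y t /set_mem Ax /set_mem Ay].
  by apply: set_mem; apply: (cA x y (Itv01 t0 t1)); apply: mem_set.
by apply/mem_set/cA => //; rewrite ge0 le1.
Qed.

Definition dot c x := \sum_(i < d) c 0 i * x 0 i.

Lemma dot_conv c x y (t : R) :
  dot c (t *: x + (1 - t) *: y) = t * dot c x + (1 - t) * dot c y.
Proof.
rewrite /dot !mulr_sumr -big_split; apply: eq_bigr => i _ /=.
by rewrite !mxE mulrDr !mulrA ![c 0 i * _]mulrC.
Qed.

Lemma convex_hull (S : set 'rV[R]_d) : convex_set (conv_hull S).
Proof.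
apply/convexP => x y t Sx Sy t01 M [cM SM].
by move/convexP: (cM); apply=> //; [apply: Sx|apply: Sy].
Qed.

Definition sign_vector u : 'rV[R]_d := \row_j (if u j then 1 else -1).
Definition sign_pattern x : V := [ffun j => x 0 j == 1].

Lemma sign_vectorK : cancel sign_vector sign_pattern.
Proof.
move=> u; apply/ffunP => j; rewrite ffunE mxE; case: (u j); rewrite ?eqxx //.
by apply/negbTE; apply/eqP; lra.
Qed.

Lemma sign_vector_cube u : Q (sign_vector u).
Proof.
by apply: sub_gen_smallest => i; rewrite mxE; case: (u i); [left|right].
Qed.

Lemma cube_ind (A : set 'rV[R]_d) : convex_set A ->
  (forall u, A (sign_vector u)) -> Q `<=` A.
Proof.
move=> cA As; apply: smallest_sub => // x xs.
suff -> : x = sign_vector (sign_pattern x) by [].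
apply/rowP => j; rewrite mxE ffunE; case: eqVneq => [->//|/eqP x1].
by have [] := xs j.
Qed.

Lemma cube_le1 x j : Q x -> -1 <= x 0 j <= 1.
Proof.
move: x; apply: (@cube_ind [set x | -1 <= x 0 j <= 1]).
  apply/convexP => x y t /= /andP[x1 x2] /andP[y1 y2] /andP[t0 t1].
  by rewrite !mxE; nra.
by move=> u /=; rewrite mxE; case: (u j); lra.
Qed.

(** If [x] is no sign vector, the functional exposing [x] is strictly below its maximum at all sign
    vectors. This strict inequality defines a convex set, so it would hold on the whole cube,
    including at [x]. *)
Lemma vertices_sign x : vertices Q x -> exists u, x = sign_vector u.
Proof.
case=> c [m [Pm xF]].
have [Px xm] : Q x /\ dot c x = m by have : [set x] x by []; rewrite xF.
apply: contrapT => nx.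
have lt_m : Q `<=` [set y | dot c y < m].
  apply: cube_ind => [|u /=].
    apply/convexP => a b t /= am bm /andP[t0 t1]; rewrite dot_conv.
    have [->|t0'] := eqVneq t 0; first by rewrite mul0r subr0 mul1r add0r.
    have : 0 < t by rewrite lt_neqAle eq_sym t0'.
    nra.
  rewrite lt_neqAle (Pm _ (sign_vector_cube u)) andbT; apply/eqP => um; apply: nx.
  exists u; have : [set x] (sign_vector u) by rewrite xF; split=> //; apply: sign_vector_cube.
  by move->.
by have := lt_m x Px; rewrite /= xm ltxx.
Qed.

(* The functional [Sum_(j in J) u_j x_j] attains its maximum [#|J|] on the cube
   at the points that agree with [u] on [J]. *)
Definition face_functional u (J : {set 'I_d}) : 'rV[R]_d :=
  \row_j (if j \in J then sign_vector u 0 j else 0).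

Lemma face_functional_le u J x : Q x ->
  dot (face_functional u J) x <= #|J|%:R ?= iff
    [forall (j | j \in J), x 0 j == sign_vector u 0 j].
Proof.
move=> Px; rewrite -sum1_card natr_sum big_mkcond /= /dot.
have -> : [forall (j | j \in J), x 0 j == sign_vector u 0 j] =
   [forall j, (j \in J) ==> (x 0 j == sign_vector u 0 j)] by [].
apply: leif_sum => j _; rewrite !mxE; have /andP[x1 x2] := cube_le1 j Px.
case: (j \in J) => /=; last by rewrite mul0r; apply/leif_refl.
apply/leifP; case: (u j); case: eqVneq => [->|/eqP ne]; rewrite ?mul1r ?mulN1r ?opprK //.
  by rewrite lt_neqAle x2 andbT; apply/eqP.
by rewrite lt_neqAle lerNl x1 andbT; apply/eqP => E; apply: ne; rewrite -[x 0 j]opprK E.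
Qed.

Lemma is_face_functional u (J : {set 'I_d}) :
  is_face Q [set x | Q x /\ forall j, j \in J -> x 0 j = sign_vector u 0 j].
Proof.
exists (face_functional u J), #|J|%:R; split=> [x Px|].
  exact: (face_functional_le u J Px).1.
apply/seteqP; split=> x /= [Px H]; split=> //.
  by apply/eqP; rewrite -/(dot _ _) (face_functional_le u J Px).2; apply/forall_inP => j /H ->.
by move/eqP: H; rewrite -/(dot _ _) (face_functional_le u J Px).2 => /forall_inP H j /H /eqP.
Qed.

Lemma sign_vertex u : vertices Q (sign_vector u).
Proof.
rewrite /vertices /=; have := is_face_functional u [set: 'I_d]%SET; congr (is_face _ _).
apply/seteqP; split=> x /= => [[_ H]|->]; first by apply/rowP => j; apply: H; rewrite inE.
by split=> //; apply: sign_vector_cube.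
Qed.

Lemma sign_adjacent u w : adj u w -> adjacent Q (sign_vector u) (sign_vector w).
Proof.
case/existsP=> i /eqP->; apply/asboolP; split; try exact: sign_vertex.
  by move/(can_inj sign_vectorK)/esym/eqP; rewrite (negPf (flip_neq _ _)).
have := is_face_functional u (~: [set i]%SET)%SET; congr (is_face _ _).
apply/seteqP; split=> x /=.
  case=> Px H M [/convexP cM uM].
  have /andP[x1 x2] := cube_le1 i Px.
  have [Mu Mf] : M (sign_vector u) /\ M (sign_vector (flip i u)).
    by split; apply: uM; [left|right].
  (* Solves [x_i = t * u_i - (1 - t) * u_i], where [u_i] is 1 or -1. *)
  pose t := (1 + sign_vector u 0 i * x 0 i) / 2.
  have -> : x = t *: sign_vector u + (1 - t) *: sign_vector (flip i u).
    apply/rowP => j; rewrite 2!mxE [in RHS]mxE; case: (eqVneq j i) => [->|ji].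
      by rewrite /t !mxE flip_i; case: (u i) => /=; lra.
    by rewrite H ?inE // !mxE ffunE (negPf ji) addbF; case: (u j); lra.
  by apply: cM => //; rewrite /t mxE; case: (u i); lra.
pose F := [set y | Q y /\ forall j, j \in (~: [set i])%SET -> y 0 j = sign_vector u 0 j].
suff : conv_hull [set sign_vector u; sign_vector (flip i u)] `<=` F by apply.
apply: smallest_sub.
  apply/convexP => a b t [Pa Ha] [Pb Hb] t01; split.
    by move/convexP: (@convex_hull [set v | forall i, v 0 i = 1 \/ v 0 i = -1]); apply.
  by move=> j jJ; rewrite !mxE Ha // Hb // !mxE; case: (u j); lra.
move=> y [->|->]; split=> //; try exact: sign_vector_cube.
by move=> j; rewrite !inE => ji; rewrite !mxE ffunE (negPf ji) addbF.
Qed.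

Lemma cube_polytope : is_polytope d Q.
Proof.
exists [seq sign_vector u | u <- enum V]; split.
- have : [ffun => false] \in enum V by rewrite mem_enum.
  by case: (enum V).
- congr conv_hull; apply/seteqP; split=> x /=.
    move=> xs; apply/mapP; exists (sign_pattern x); first by rewrite mem_enum.
    apply/rowP => j; rewrite mxE ffunE; case: eqVneq => [->//|/eqP x1].
    by have [] := xs j.
  by case/mapP=> u _ -> i; rewrite mxE; case: (u i); [left|right].
set s := [seq sign_vector u | u <- enum V].
have ms u : sign_vector u \in s by apply: map_f; rewrite mem_enum.
set B := [seq _ | _ <- _, _ <- _].
have mB j : (delta_mx 0 j : 'rV[R]_d) \in <<B>>%VS.
  have -> : delta_mx 0 j = 2^-1 *:
      (sign_vector (flip j [ffun => false]) - sign_vector [ffun => false]).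
    apply/rowP => l; rewrite !mxE !ffunE /=; case: eqVneq => _ /=; lra.
  by apply/memvZ/memv_span/allpairs_f.
suff -> : <<B>>%VS = fullv by rewrite dimvf dim_matrix mul1r.
apply/vspaceP => x; rewrite memvf; rewrite [x]row_sum_delta.
by apply: memv_suml => j _; apply: memvZ.
Qed.

Lemma card_cube_vertices : (`I_d.+1 #<= vertices Q)%card.
Proof.
(* The first [m] coordinates are 1 and the others -1; [m] from 0 to [d] gives [d.+1] distinct
   vertices. *)
pose g (m : nat) : 'rV[R]_d := sign_vector [ffun j : 'I_d => (j < m)%N].
have gi : {in `I_d.+1 &, injective g}.
  have lt_neq a b : (b <= d)%N -> (a < b)%N -> g a <> g b.
    move=> bd ab /(can_inj sign_vectorK)/ffunP E.
    have ad := leq_trans ab bd.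
    by have := E (Ordinal ad); rewrite !ffunE /= ltnn ab.
  move=> a b /set_mem /= ad /set_mem /= bd E.
  by case: (ltngtP a b) => // ab; [have := lt_neq a b bd ab|have := lt_neq b a ad ab]; rewrite E.
have /card_eqPle[_ le] := inj_card_eq gi.
apply: card_le_trans le (subset_card_le _).
by move=> _ [m _ <-]; apply: sign_vertex.
Qed.

(** Carries the cardinality of a set of real points over to finite sets, by composing [sign_vector]
    with an injection of [X] into [I_n]. *)
Lemma card_sign_patterns (X : set 'rV[R]_d) n : (X #= `I_n)%card ->
  (#|[set u | `[< X (sign_vector u) >]]%SET| <= n)%N.
Proof.
move=> /card_eqPle[/pcard_leP[f] _].
set F := [set u | _]%SET.
have fn u : u \in F -> (f (sign_vector u) < n)%N.
  by rewrite inE => /asboolP uX; have := @funS _ _ _ _ f _ uX.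
have [->|[u0 u0F]] := set_0Vmem F; first by rewrite cards0.
have n0 : (0 < n)%N by apply: leq_ltn_trans (fn _ u0F).
rewrite -[X in (_ <= X)%N]card_ord.
pose h u : 'I_n := insubd (Ordinal n0) (f (sign_vector u)).
rewrite -(@card_in_imset _ _ h); first exact: max_card.
move=> u w uF wF /(congr1 val); rewrite !val_insubd !fn // => E.
apply: (can_inj sign_vectorK); apply: (@inj _ _ _ f) E; apply: mem_set;
  by apply/asboolP; move: uF wF; rewrite !inE.
Qed.
End Cube.

(* Transfer of linkages from the combinatorial to the geometric cube *)
Local Close Scope classical_set_scope.
Local Close Scope ring_scope.

Theorem theorem28 (R : realType) (d : nat) (hd1 : (1 <= d)%N) (hd3 : d <> 3) :
  @strongly_linked R d d (@cube R d).
Proof.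
split; [exact: cube_polytope|exact: card_cube_vertices|].
move=> X XV cX s t st s_inj t_inj s_t; set k := (d.+1)./2 in s t st s_inj t_inj s_t *.
pose e (i : 'I_k) (b : bool) := if b then t i else s i.
have eX i b : X (e i b) by case: b; [exact: (st i).2|exact: (st i).1].
have XK x : X x -> sign_vector R (sign_pattern x) = x.
  by move=> /XV/vertices_sign[u ->]; rewrite sign_vectorK.
pose F := [set u | `[< X (sign_vector R u) >]]%SET.
pose e' i b := sign_pattern (e i b).
have tF : terminals F [set: 'I_k]%SET e'.
  split=> [i b _|i i' b b' _ _ /(congr1 (@sign_vector R d))].
    by rewrite inE; apply/asboolP; rewrite XK.
  rewrite !XK //; case: b b' => [] [] /= E.
  - by have := t_inj _ _ E.
  - by case: (s_t i' i).
  - by case: (s_t i i').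
  - by have := s_inj _ _ E.
have cF := card_sign_patterns cX; rewrite -/F in cF.
have FD : F \subset subcube [set: 'I_d]%SET [ffun => false].
  by apply/fintype.subsetP => u _; apply/subcubeP => j; rewrite inE.
(* Here [d <> 3] enters: there is a single pair for [d] equal to 1 or 2, but there would be two for
   3. *)
have k1 : #|[set: 'I_k]%SET| <= 1 \/ 4 <= d.
  by rewrite cardsT card_ord /k; lia.
have cD : #|[set: 'I_d]%SET| = d by rewrite cardsT card_ord.
have [C [_ Cl CX Cd]] := linkable_all hd1 cD FD cF tF k1.
have /choice[L HL] : forall i, exists p, [/\ path (@adj 'I_d) (e' i false) p,
    last (e' i false) p = e' i true, uniq (e' i false :: p) &
    {subset e' i false :: p <= C i}].
  by move=> i; apply/linkedP/Cl; rewrite inE.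
have LE i : s i :: map (@sign_vector R d) (L i) = map (@sign_vector R d) (e' i false :: L i).
  by rewrite /= XK //; apply: eX.
exists (fun i => map (@sign_vector R d) (L i)); split.
- move=> i; have [pp lp up _] := HL i; split.
  + by apply: XV; apply: (st i).1.
  + rewrite -[s i]XK; last by apply: (st i).1.
    by rewrite path_map; apply: sub_path pp => u w; apply: sign_adjacent.
  + rewrite -[s i]XK; last by apply: (st i).1.
    by rewrite last_map lp XK //; apply: (st i).2.
  + by rewrite LE map_inj_uniq //; apply: can_inj (@sign_vectorK R d).
- move=> i j ij x; rewrite !LE => /mapP[u uL ->].
  rewrite mem_map; last exact: can_inj (@sign_vectorK R d).
  have [_ _ _ si] := HL i; have [_ _ _ sj] := HL j.
  apply/negP => /sj uj; have /pred0P/(_ u) := Cd i j (finset.in_setT i) (finset.in_setT j) ij.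
  by rewrite /= si // uj.
- move=> i x; rewrite LE => /mapP[u uL ->] uX.
  have [_ _ _ si] := HL i.
  have [|b ->] := CX i u (finset.in_setT i) (si u uL); first by rewrite inE; apply/asboolP.
  by exists i; rewrite XK //; case: b; [right|left].
Qed.
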